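(* Let $I$ be a countable set of indices and $(G_i)_{i\in I}$ a family of non-trivial subgroups of $(\mathbb{Q},+)$. Then there exists $\omega\in\mathbb{R}^{\mathbb{N}}$ such that the Kronecker flow $(\mathbb{T}^{\mathbb{N}},\Phi_\omega)$ has frequency module $\mathscr{M}_\omega$ isomorphic to $\bigoplus_{i\in I}G_i$. Moreover, the closure of any orbit of this flow is homeomorphic to a product $\prod_{i\in I}X_i$, where each factor $X_i$ is a circle if $G_i$ is free, and a solenoid otherwise.
   Context: $\mathbb{N}=\{1,2,\dots\}$, $\mathbb{T}=\mathbb{R}/2\pi\mathbb{Z}$ is the circle, and $\mathbb{T}^{\mathbb{N}}$ carries the product topology; products of spaces carry the product topology. For $\omega=(\omega_j)_{j\in\mathbb{N}}\in\mathbb{R}^{\mathbb{N}}$ the Kronecker flow is $\Phi_\omega^t(\theta)=(\Theta_j+\omega_jt+2\pi\mathbb{Z})_{j\in\mathbb{N}}$, where $\theta_j=\Theta_j+2\pi\mathbb{Z}$. $\mathbb{Z}^{(\mathbb{N})}$ is the group of finitely supported integer sequences, and the frequency module is the additive subgroup $\mathscr{M}_\omega=\{\sum_j\omega_j\nu_j:\nu\in\mathbb{Z}^{(\mathbb{N})}\}$ of $\mathbb{R}$. ''Free'' means free abelian. $\Sigma$ is the set of sequences $\mathbf{a}=(a_j)_{j\in\mathbb{N}}$ of natural numbers with $a_1=1$ and $a_j>1$ for all $j>1$. A solenoid is a subgroup of $\mathbb{T}^{\mathbb{N}}$ of the form $\sigma_{\mathbf{a}}=\{\theta=(\Theta_j+2\pi\mathbb{Z})_{j\in\mathbb{N}}\in\mathbb{T}^{\mathbb{N}}:\Theta_j=a_{j+1}\Theta_{j+1}\bmod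 2\pi\ \ \forall j\in\mathbb{N}\}$ with $\mathbf{a}\in\Sigma$, with the subspace topology. *)

(* Defs.v *)
From HB Require Import structures.
From mathcomp Require Import all_boot all_order all_algebra.
From mathcomp Require Import generic_quotient ring_quotient.
From mathcomp Require Import all_classical all_reals all_analysis.

Set Implicit Arguments.
Unset Strict Implicit.
Unset Printing Implicit Defensive.

Import Order.TTheory GRing.Theory Num.Theory.
Import numFieldNormedType.Exports.

Local Open Scope classical_set_scope.
Local Open Scope ring_scope.
Local Open Scope quotient_scope.

(* Sequences indexed by {1, 2, ...} are functions on nat, with term j of the
   sequence at j.-1. *)

Definition groups_isomorphic (U V : zmodType) (A : set U) (B : set V) : Prop :=
  exists f : U -> V,
    (forall x y, A x -> A y -> f (x + y) = f x + f y) /\ set_bij A B f.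

Definition direct_sum (I : Type) (V : zmodType) (G : I -> set V) :
    set (I -> V) :=
  [set x | finite_set [set i | x i != 0] /\ forall i, G i (x i)].

Definition fin_supp_int (J : Type) : set (J -> int) :=
  direct_sum (fun _ : J => [set: int]).

Definition free_abelian (V : zmodType) (A : set V) : Prop :=
  exists J : Type, groups_isomorphic (@fin_supp_int J) A.

Definition homeomorphic (X Y : topologicalType) : Prop :=
  exists (f : X -> Y) (g : Y -> X),
    [/\ cancel f g, cancel g f, continuous f & continuous g].

Section circle.
Variable R : realType.

Definition two_pi_int : {pred R} :=
  fun x => `[< exists k : int, x = 2 * pi * k%:~R >].

Lemma two_pi_int_zmod_closed : zmod_closed two_pi_int.
Proof.
split; first by apply/asboolP; exists 0; rewrite mulr0.
move=> x y /asboolP[k ->] /asboolP[l ->]; apply/asboolP; exists (k - l).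
by rewrite intrB mulrBr.
Qed.

HB.instance Definition _ :=
  GRing.isZmodClosed.Build R two_pi_int two_pi_int_zmod_closed.

Local Notation quot := (Quotient.quot two_pi_int).

(* quotient_topology carries no group structure; the addition of R / 2 pi Z
   below is the one of Quotient.quot. *)
Definition circle : Type := quotient_topology quot.

HB.instance Definition _ := Topological.on circle.
HB.instance Definition _ := Quotient.on circle.
HB.instance Definition _ := GRing.isZmodule.Build circle
  (@Quotient.addqA _ two_pi_int) (@Quotient.addqC _ two_pi_int)
  (@Quotient.add0q _ two_pi_int) (@Quotient.addNq _ two_pi_int).

Definition to_circle (x : R) : circle := \pi_circle x.

Lemma to_circleD x y : to_circle (x + y) = to_circle x + to_circle y.
Proof. exact: Quotient.pi_add. Qed.

Lemma to_circle0 : to_circle 0 = 0.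
Proof. by apply: (addrI (to_circle 0)); rewrite -to_circleD !addr0. Qed.

Lemma to_circleMn x n : to_circle (x *+ n) = to_circle x *+ n.
Proof.
elim: n => [|n IHn]; first by rewrite !mulr0n to_circle0.
by rewrite !mulrS to_circleD IHn.
Qed.

Lemma to_circle_eq x y :
  to_circle x = to_circle y <-> exists k : int, x - y = 2 * pi * k%:~R.
Proof.
have e := @Quotient.idealrBE R two_pi_int x y.
by split=> h; [apply/asboolP; apply: etrans e _|];
  apply/(@eqP quot) => //; apply: etrans (esym e) _; exact/asboolP.
Qed.

Lemma circle_openE (U : set circle) : open U <-> open (to_circle @^-1` U).
Proof. by []. Qed.

Definition torus : topologicalType := {ptws nat -> circle}.

Definition kronecker_flow (omega : nat -> R) (t : R) (theta : torus) : torus :=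
  fun j => theta j + to_circle (omega j * t).

Lemma kronecker_flowE omega t (Theta : nat -> R) :
  kronecker_flow omega t (fun j => to_circle (Theta j)) =
  fun j => to_circle (Theta j + omega j * t).
Proof. by apply/funext => j; rewrite to_circleD. Qed.

Definition flow_orbit (omega : nat -> R) (theta : torus) : set torus :=
  [set kronecker_flow omega t theta | t in [set: R]].

Definition frequency_module (omega : nat -> R) : set R :=
  [set \sum_(j \in [set: nat]) omega j * (nu j)%:~R
    | nu in @fin_supp_int nat].

Definition solenoid_index : set (nat -> nat) :=
  [set a | a 0%N = 1%N /\ forall j, (0 < j)%N -> (1 < a j)%N].

Definition solenoid (a : nat -> nat) : set torus :=
  [set theta | forall j, theta j = theta j.+1 *+ a j.+1].

Lemma solenoidE a (Theta : nat -> R) :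
  solenoid a (fun j => to_circle (Theta j)) <->
  forall j, exists k : int,
    Theta j - (a j.+1)%:R * Theta j.+1 = 2 * pi * k%:~R.
Proof.
by split=> h j; move: (h j); rewrite mulr_natl -to_circleMn => /to_circle_eq.
Qed.

End circle.

Definition orbit_factor (R : realType) (G : set rat) (a : nat -> nat) :
    topologicalType :=
  if `[< free_abelian G >] then (circle R : topologicalType)
  else (set_type (@solenoid R a) : topologicalType).

(* Main.v *)
Require Import Defs.
From mathcomp Require Import finmap all_boot all_order all_algebra.
From mathcomp Require Import all_classical all_reals all_analysis.
From mathcomp Require Import ring lra zify.

(** Each G_i is the union of an increasing chain of cyclic groups, generated by
    g_{i,0}, g_{i,1}, ... with g_{i,k} = a_{i,k+1} g_{i,k+1}: the chain is
    constant if G_i is cyclic, that is, free, and can be chosen with all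
    a_{i,k+1} > 1 otherwise ([generator_chain_exists], [free_abelianP]).
    Let c_0, c_1, ... be real numbers such that, for nonzero rationals q_i,
    the linear flow with velocities c_i q_i is dense in every
    finite-dimensional torus. Index the coordinates of the infinite torus by
    the pairs (i, k), and let the coordinate (i, k) move with velocity
    omega_{i,k} = c_i g_{i,k}.

    Density makes the c_i linearly independent over the rationals
    ([dense_independent]), so that the group generated by the omega_{i,k} is
    the direct sum of the groups c_i G_i, hence isomorphic to the direct sum
    of the G_i ([frequency_module_isomorphic]).

    The orbit of 0 lies in the closed subgroup of the torus given by the
    equations theta_{i,k} = a_{i,k+1} theta_{i,k+1}. It is dense there, because
    the coordinates (i, k) with k <= K are integral multiples of the coordinate
    (i, K), which reduces every approximation problem to finitely many
    coordinates with velocities c_i g_{i,K} ([chain_group_approx]). Therefore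
    the closure of the orbit of theta is the coset of theta
    ([closure_flow_orbit]), and it is the product over i of the solenoids of
    the sequences a_i ([chain_group_homeomorphic]); in the free case the
    solenoid of the constant sequence 1 is the diagonal, a circle
    ([diagonal_homeomorphic]).

    Since the c_i may be chosen freely, the general form of Kronecker's
    theorem is avoided: the c_i are sums of series of terms d_i(k) / (k+1)!
    with d_i(k) <= k. Modulo 1, k! c_i is within 1 / (k+1) of d_i(k) / (k+1),
    so that density at the integral times k! follows when the digits run
    through all finite lists of rational targets ([dense_sequence]). *)

Set Implicit Arguments.
Unset Strict Implicit.
Unset Printing Implicit Defensive.

Import Order.TTheory GRing.Theory Num.Theory.
Import numFieldNormedType.Exports.

Local Open Scope classical_set_scope.
Local Open Scope ring_scope.

(** * Continuity and homeomorphisms for product and subspace topologies *)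

Lemma cvg_prod_topology (I : Type) (T : I -> topologicalType)
    (F : set_system (prod_topology T)) (p : prod_topology T) :
  Filter F ->
  (forall i, (fun f : prod_topology T => f i) @ F --> p i) -> F --> p.
Proof.
move=> FF cvgp; apply/cvg_sup => i U [_ [[W oW <-] /= Wpi] WU].
by apply: filterS WU _; apply: (cvgp i); apply: open_nbhs_nbhs.
Qed.

Lemma continuous_prod_topology (Z : topologicalType) (I : Type)
    (T : I -> topologicalType) (f : Z -> prod_topology T) :
  (forall i, continuous (fun z => f z i)) -> continuous f.
Proof. by move=> cf z; apply: cvg_prod_topology => i; exact: cf. Qed.

Lemma continuous_eval (I : eqType) (T : I -> topologicalType) (i : I) :
  continuous (fun f : prod_topology T => f i).
Proof. exact: proj_continuous. Qed.

Lemma continuous_set_type (Z X : topologicalType) (A : set X)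
    (f : Z -> set_type A) :
  continuous (fun z => set_val (f z)) -> continuous f.
Proof.
move=> /continuousP cf; apply/continuousP => _ [W oW <-].
exact: cf.
Qed.

Lemma continuous_set_val (X : topologicalType) (A : set X) :
  continuous (set_val : set_type A -> X).
Proof. exact: initial_continuous. Qed.

Lemma homeomorphic_refl (X : topologicalType) : homeomorphic X X.
Proof. by exists id, id; split=> // x; exact: cvg_id. Qed.

Lemma homeomorphic_trans (X Y Z : topologicalType) :
  homeomorphic X Y -> homeomorphic Y Z -> homeomorphic X Z.
Proof.
move=> [f [f' [fK f'K cf cf']]] [g [g' [gK g'K cg cg']]].
exists (g \o f), (f' \o g'); split.
- exact: can_comp.
- exact: can_comp.
- by move=> x; apply: continuous_comp; [exact: cf|exact: cg].
- by move=> x; apply: continuous_comp; [exact: cg'|exact: cf'].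
Qed.

Lemma homeomorphic_prod (I : eqType) (X Y : I -> topologicalType) :
  (forall i, homeomorphic (X i) (Y i)) ->
  homeomorphic (prod_topology X) (prod_topology Y).
Proof.
move=> XY.
have H i : {fg : (X i -> Y i) * (Y i -> X i) | [/\ cancel fg.1 fg.2,
    cancel fg.2 fg.1, continuous fg.1 & continuous fg.2]}.
  by apply: cid; have [f [g fg]] := XY i; exists (f, g).
exists (fun x i => (sval (H i)).1 (x i)), (fun y i => (sval (H i)).2 (y i)).
split=> [x|y||].
- by apply: functional_extensionality_dep => i; case: (svalP (H i)).
- by apply: functional_extensionality_dep => i; case: (svalP (H i)).
- apply: continuous_prod_topology => i x.
  apply: (@continuous_comp _ _ _ (fun f : prod_topology X => f i)).
    exact: continuous_eval.
  by case: (svalP (H i)) => _ _ + _; apply.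
- apply: continuous_prod_topology => i x.
  apply: (@continuous_comp _ _ _ (fun f : prod_topology Y => f i)).
    exact: continuous_eval.
  by case: (svalP (H i)) => _ _ _; apply.
Qed.

Lemma continuous_eval_set_val (I : eqType) (T : I -> topologicalType)
    (A : set (prod_topology T)) (i : I) :
  continuous (fun x : set_type A => set_val x i).
Proof.
move=> x; apply: (@continuous_comp _ _ _ set_val (fun f : prod_topology T => f i)).
  exact: continuous_set_val.
exact: continuous_eval.
Qed.

(** * The topology of the circle group *)

Section circle_topology.
Variable R : realType.
Local Notation circle := (circle R).
Implicit Types (x y : R) (p q : circle).

Lemma to_circle_surj p : exists x, p = to_circle x.
Proof. by exists (repr p); rewrite /to_circle reprK. Qed.

Lemma to_circleB x y : to_circle (x - y) = to_circle x - to_circle y.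
Proof. by apply/eqP; rewrite -subr_eq opprK -to_circleD subrK. Qed.

Lemma to_circleN x : to_circle (- x) = - to_circle x.
Proof. by rewrite -[- x]sub0r to_circleB to_circle0 sub0r. Qed.

Lemma to_circle_continuous : continuous (@to_circle R).
Proof. exact: pi_continuous. Qed.

Lemma to_circle2pi x (k : int) : to_circle (x + 2 * pi * k%:~R) = to_circle x.
Proof. by apply/to_circle_eq; exists k; rewrite addrAC subrr add0r. Qed.

(** The projection onto the circle is open: the preimage of the image of an
    open set is the union of its translates by the multiples of 2 pi. *)
Lemma nbhs_to_circle x (U : set circle) :
  nbhs (to_circle x) U <-> nbhs x (@to_circle R @^-1` U).
Proof.
split=> [|xU]; first exact: to_circle_continuous.
rewrite nbhsE; exists (@to_circle R @` (@to_circle R @^-1` U)°); last first.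
  by move=> _ [y /interior_subset ? <-].
split; last by exists x.
apply/circle_openE.
rewrite (_ : _ @^-1` _ = \bigcup_(k : int)
    (fun y => y + 2 * pi * k%:~R) @^-1` (@to_circle R @^-1` U)°).
  apply: bigcup_open => k _; apply: open_comp; last exact: open_interior.
  by move=> y _; apply: cvgD; [exact: cvg_id|exact: cvg_cst].
apply/seteqP; split=> [y [z zU]|y [k _ ykU]] /=.
  by move=> /to_circle_eq[k zyk]; exists k => //=; rewrite -zyk addrC subrK.
by exists (y + 2 * pi * k%:~R) => //; exact: to_circle2pi.
Qed.

Lemma circleD_continuous (T : topologicalType) (f g : T -> circle) :
  continuous f -> continuous g -> continuous (fun t => f t + g t).
Proof.
move=> cf cg t U.
have [x fx] := to_circle_surj (f t); have [y gy] := to_circle_surj (g t).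
rewrite fx gy -to_circleD nbhs_to_circle => xyU.
have [[A B] /= [xA yB] ABU] : nbhs (x, y) [set z : R * R | U (to_circle (z.1 + z.2))].
  have xyc : z.1 + z.2 @[z --> (x, y)] --> x + y.
    by apply: cvgD; [exact: cvg_fst|exact: cvg_snd].
  exact: (xyc _ xyU).
have oA : nbhs (f t) (@to_circle R @` A).
  rewrite fx nbhs_to_circle; apply: filterS xA => z Az; by exists z.
have oB : nbhs (g t) (@to_circle R @` B).
  rewrite gy nbhs_to_circle; apply: filterS yB => z Az; by exists z.
have ft : nbhs t (f @^-1` (@to_circle R @` A)) := cf t _ oA.
have gt : nbhs t (g @^-1` (@to_circle R @` B)) := cg t _ oB.
apply: filterS (filterI ft gt) => s /= [[a Aa <-] [b Bb <-]].
by rewrite -to_circleD; apply: (ABU (a, b)).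
Qed.

Lemma circleN_continuous (T : topologicalType) (f : T -> circle) :
  continuous f -> continuous (fun t => - f t).
Proof.
move=> cf t U; have [x fx] := to_circle_surj (f t).
rewrite fx -to_circleN nbhs_to_circle => xU.
have oA : nbhs (f t) (@to_circle R @` [set z | U (to_circle (- z))]).
  rewrite fx nbhs_to_circle.
  have xN : nbhs x (-%R @^-1` (@to_circle R @^-1` U)) :=
    @opp_continuous R x _ xU.
  by apply: filterS xN => z Uz; exists z.
have ft : nbhs t (f @^-1` _) := cf t _ oA.
apply: filterS ft => s /= [a Ua <-].
by rewrite -to_circleN.
Qed.

Lemma circleMn_continuous (T : topologicalType) (f : T -> circle) n :
  continuous f -> continuous (fun t => f t *+ n).
Proof.
move=> cf; elim: n => [|n IHn].
  by under eq_fun do rewrite mulr0n; move=> t; exact: cvg_cst.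
by under eq_fun do rewrite mulrS; exact: circleD_continuous.
Qed.

(** The preimage of the complement is the union of the open intervals between
    consecutive multiples of 2 pi. *)
Lemma circle_closed0 : closed [set (0 : circle)].
Proof.
rewrite -[X in closed X]setCK; apply: open_closedC; apply/circle_openE.
have pi2 : 0 < 2 * pi :> R by rewrite mulr_gt0 // pi_gt0.
rewrite (_ : _ @^-1` _ = \bigcup_(k : int)
    `]2 * pi * k%:~R, 2 * pi * (k + 1)%:~R[%classic).
  by apply: bigcup_open => k _; exact: itv_open.
apply/seteqP; split=> [x /= x0|x [k _] /=].
  have := floor_itv (x / (2 * pi)).
  set k := Num.floor _; rewrite ler_pdivlMr// ltr_pdivrMr// => /andP[kx xk].
  exists k => //=; rewrite in_itv /= !(mulrC (2 * pi)) xk andbT.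
  rewrite lt_neqAle kx andbT; apply/eqP => kxE; apply: x0.
  by rewrite -to_circle0; apply/to_circle_eq; exists k; rewrite subr0 mulrC.
rewrite in_itv /= -to_circle0 => /andP[kx xk] /to_circle_eq[l].
rewrite subr0 => xl; move: kx xk; rewrite xl !ltr_pM2l // !ltr_int; lia.
Qed.

End circle_topology.

(** * Frequencies with dense flow *)

Section cantor.
Variable R : realType.

(** Take for c the sum of the series of terms d_k / (k+1)!, a Cantor series: in
    k! c the terms before the k-th are integers, the k-th is d_k / (k+1), and
    those after it telescope to at most 1 / (k+1). Hence the digit d_k alone
    prescribes k! c modulo 1, up to an error 1 / (k+1). *)
Lemma cantor_series (d : nat -> nat) : (forall k, (d k <= k)%N) ->
  exists c : R, forall k, exists N : nat,
    0 <= k`!%:R * c - N%:R - (d k)%:R / k.+1%:R <= k.+1%:R^-1.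
Proof.
move=> dk; pose S n : R := \sum_(k < n) (d k)%:R / (k.+1)`!%:R.
have fact0 k : (0 : R) < k`!%:R by rewrite ltr0n fact_gt0.
have SS k : S k.+1 = S k + (d k)%:R / (k.+1)`!%:R by rewrite /S big_ord_recr.
have factS k : (k.+1)`!%:R = k.+1%:R * k`!%:R :> R by rewrite -natrM.
have S_ge k n : S k <= S (k + n)%N.
  elim: n => [|n IHn]; first by rewrite addn0.
  by rewrite addnS SS; apply: (le_trans IHn); rewrite lerDl divr_ge0// ltW.
(* The bound d_l <= l makes the sum of 1 / l! and of the terms before the l-th
   nonincreasing in l. *)
have S_le k n : S (k + n)%N + (k + n)`!%:R^-1 <= S k + k`!%:R^-1.
  elim: n => [|n IHn]; first by rewrite addn0.
  apply: le_trans IHn; rewrite addnS SS -addrA lerD2l.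
  rewrite -[X in _ + X]mul1r -mulrDl ler_pdivrMr//.
  rewrite [in leRHS]factS mulrCA mulVf ?gt_eqF// mulr1.
  by rewrite natr1 ler_nat ltnS.
pose c := sup (range S).
have cS : has_sup (range S).
  split; first by exists (S 0%N); exists 0%N.
  exists (S 0%N + 0`!%:R^-1) => _ [n _ <-].
  by apply: le_trans (S_le 0%N n); rewrite add0n lerDl invr_ge0 ltW.
have cge k : S k <= c by apply: sup_upper_bound => //; exists k.
have cle k : c <= S k + k`!%:R^-1.
  apply: ge_sup; first by exists (S 0%N); exists 0%N.
  move=> _ [n _ <-]; have [nk|kn] := leqP n k.
    rewrite -(subnKC nk); apply: le_trans (S_ge n (k - n)%N) _.
    by rewrite lerDl invr_ge0 ltW.
  rewrite -(subnKC (ltnW kn)); apply: le_trans (S_le k (n - k)%N).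
  by rewrite lerDl invr_ge0 ltW.
have intS k : exists N : nat, k`!%:R * S k = N%:R.
  elim: k => [|k [N IHk]]; first by exists 0%N; rewrite /S big_ord0 mulr0.
  exists (k.+1 * N + d k)%N; rewrite SS mulrDr factS -mulrA IHk -factS.
  by rewrite mulrCA mulfV ?gt_eqF// mulr1 natrD natrM.
exists c => k; have [N SN] := intS k; exists N.
have -> : k`!%:R * c - N%:R - (d k)%:R / k.+1%:R = k`!%:R * (c - S k.+1).
  rewrite -SN SS factS invfM; field.
  by rewrite gt_eqF//= addrC natr1 pnatr_eq0.
rewrite mulr_ge0 ?subr_ge0 ?(ltW (fact0 k))//=.
have -> : k.+1%:R^-1 = k`!%:R * (k.+1)`!%:R^-1 :> R.
  by rewrite factS invfM mulrCA mulfV ?gt_eqF// mulr1.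
by rewrite ler_pM2l// lerBlDl.
Qed.

Lemma inj_unbounded (f : nat -> nat) : injective f ->
  forall N, exists2 m, (N <= m)%N & (N <= f m)%N.
Proof.
move=> finj N; apply: contrapT => nex.
have fN (m : 'I_N.+1) : (f (N + m) < N)%N.
  by rewrite ltnNge; apply/negP => Nf; apply: nex; exists (N + m)%N => //; lia.
have ginj : injective (fun m : 'I_N.+1 => Ordinal (fN m)).
  by move=> m m' [] /finj /addnI /val_inj.
by have := leq_card _ ginj; rewrite !card_ord ltnn.
Qed.

(** The explicit form of Kronecker's theorem: here the numbers c_i are chosen so
    as to make density easy. A natural number k codes a precision m and a
    list s of numerators, and c_i is the Cantor series whose k-th digit is
    the integral part of (k+1) s_i / (m+1). At time k! the point (c_i) is then close
    to (s_i / (m+1)) modulo 1, and every finite list of targets is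
    approximated in this way for arbitrarily large m and k. *)
Lemma dense_sequence : exists c : nat -> R,
  forall n (b : nat -> R) e, 0 < e -> exists t : nat, forall i, (i < n)%N ->
    exists l : int, `|t%:R * c i - b i - l%:~R| < e.
Proof.
pose code k : nat * seq nat := odflt (0%N, [::]) (unpickle k).
pose d i k := minn k ((k.+1 * nth 0%N (code k).2 i) %/ (code k).1.+1).
have [c cP] : {c : nat -> R & forall i k, exists N : nat,
    0 <= k`!%:R * c i - N%:R - (d i k)%:R / k.+1%:R <= k.+1%:R^-1}.
  by apply: (@choice _ _ (fun i c => forall k, exists N : nat, 0 <= k`!%:R * c -
    N%:R - (d i k)%:R / k.+1%:R <= k.+1%:R^-1)) => i;
    apply: cantor_series => k; exact: geq_minl.
exists c => n b e e0.
(* Only the fractional parts of the targets matter. *)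
pose fb i := b i - (Num.floor (b i))%:~R.
have fb0 i : 0 <= fb i < 1.
  have := floor_itv (b i); rewrite /fb subr_ge0 ltrBlDr => /andP[-> /=].
  by rewrite intrD addrC.
pose s m := mkseq (fun i => Num.truncn (m.+1%:R * fb i)) n.
(* The total error is at most 1/(m+1) + 1/(k+1) + 1/(k+1): rounding of the
   target, rounding of the digit, tail of the series. *)
have [N eN] : exists N : nat, 3 / e < N.+1%:R.
  exists (Num.truncn (3 / e)); exact: truncnS_gt.
have sinj : injective (fun m => pickle (m, s m)).
  by move=> m m' /(pcan_inj pickleK) [].
have [m Nm] := inj_unbounded sinj N; set k := pickle _ => Nk.
exists k`! => i ltin; have [l] := cP i k.
have -> : d i k = ((k.+1 * Num.truncn (m.+1%:R * fb i)) %/ m.+1)%N.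
  rewrite /d /code pickleK /= nth_mkseq//; apply/minn_idPr.
  rewrite -ltnS ltn_divLR// ltn_mul2l /=.
  rewrite -(ltr_nat R); have /andP[f0 f1] := fb0 i.
  apply: (@le_lt_trans _ _ (m.+1%:R * fb i)); first by rewrite truncn_le mulr_ge0.
  by rewrite gtr_pMr// ltr0n.
set u := Num.truncn _; set v := (_ %/ _)%N => /andP[h1 h2].
have /andP[fi0 fi1] := fb0 i.
have/andP[u1 u2] : (u%:R <= m.+1%:R * fb i < u.+1%:R).
  by apply: truncn_itv; rewrite mulr_ge0.
have v1 : v%:R * m.+1%:R <= k.+1%:R * u%:R :> R by rewrite -!natrM ler_nat leq_divM.
have v2 : k.+1%:R * u%:R <= (v%:R + 1) * m.+1%:R :> R.
  by rewrite natr1 -!natrM ler_nat ltnW// ltn_ceil.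
exists (l%:Z - Num.floor (b i)); rewrite intrB.
have mN : m.+1%:R^-1 <= N.+1%:R^-1 :> R by rewrite lef_pV2 ?posrE ?ltr0n// ler_nat.
have kN : k.+1%:R^-1 <= N.+1%:R^-1 :> R by rewrite lef_pV2 ?posrE ?ltr0n// ler_nat.
have eN' : 3 * N.+1%:R^-1 < e.
  by rewrite ltr_pdivrMr ?ltr0n// mulrC -ltr_pdivrMr.
have m0 : 0 < m.+1%:R :> R by rewrite ltr0n.
have k0 : 0 < k.+1%:R :> R by rewrite ltr0n.
have w1 : v%:R / k.+1%:R <= u%:R / m.+1%:R :> R.
  by rewrite ler_pdivrMr// mulrAC ler_pdivlMr// [leRHS]mulrC.
have w2 : u%:R / m.+1%:R <= v%:R / k.+1%:R + k.+1%:R^-1 :> R.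
  by rewrite -[X in _ + X]mul1r -mulrDl ler_pdivrMr// mulrAC ler_pdivlMr// mulrC.
have w3 : u%:R / m.+1%:R <= fb i by rewrite ler_pdivrMr// mulrC.
have w4 : fb i <= u%:R / m.+1%:R + m.+1%:R^-1.
  by rewrite -[X in _ + X]mul1r -mulrDl ler_pdivlMr// mulrC natr1 ltW.
have w5 : 0 < m.+1%:R^-1 :> R by rewrite invr_gt0.
have w6 : 0 < k.+1%:R^-1 :> R by rewrite invr_gt0.
have -> : k`!%:R * c i - b i - ((Posz l)%:~R - (Num.floor (b i))%:~R) =
  k`!%:R * c i - l%:R - fb i by rewrite /fb; ring.
move: h1 h2 mN kN eN' w1 w2 w3 w4 w5 w6.
move: (k.+1%:R^-1) (m.+1%:R^-1) (N.+1%:R^-1) (v%:R / _) (u%:R / _) => x1 x2 x3 x4 x5.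
move: (k`!%:R * c i) (fb i) (l%:R) => x6 x7 x8.
move=> *.
rewrite ltr_norml; apply/andP; split; lra.
Qed.

(** The conclusion of Kronecker's simultaneous approximation theorem: modulo
    2 pi, the linear flow with velocities c_i q_i is dense in every
    finite-dimensional torus. The rational factors are built in because the
    flow constructed below has velocities c_i g with g in a subgroup of the
    rationals. *)
Definition dense_frequencies (c : nat -> R) : Prop :=
  forall n (q : nat -> rat) (b : nat -> R) e, 0 < e ->
    (forall i, (i < n)%N -> q i != 0) ->
    exists t : R, forall i, (i < n)%N ->
      exists l : int, `|c i * ratr (q i) * t - b i - 2 * pi * l%:~R| < e.

(** Rational factors cost nothing: over a common denominator D, the multiplier
    D q_i is an integer p_i, and multiplying an approximation of b_i / p_i
    modulo 1 by p_i gives an approximation of b_i modulo 1. *)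
Lemma dense_frequencies_exist : exists c, dense_frequencies c.
Proof.
have [c cP] := dense_sequence; exists c => n q b e e0 q0.
have pi2 : 0 < 2 * pi :> R by rewrite mulr_gt0 // pi_gt0.
pose D := \prod_(i < n) denq (q i).
have D0 : D != 0 by apply/prodf_neq0 => i _; exact: denq_neq0.
have pP i : (i < n)%N -> exists p : int, q i = p%:~R / D%:~R.
  move=> ltin; pose D' := \prod_(j < n | j != Ordinal ltin) denq (q j).
  have DE : D = denq (q i) * D' by rewrite /D (bigD1 (Ordinal ltin)).
  exists (numq (q i) * D'); rewrite DE !intrM invfM.
  rewrite mulrACA mulfV ?mulr1 ?divq_num_den// intr_eq0.
  by apply/prodf_neq0 => j _; exact: denq_neq0.
pose P := 1 + \sum_(i < n) `|D%:~R * ratr (q i) : R|.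
have Pi i : (i < n)%N -> `|D%:~R * ratr (q i) : R| < P.
  move=> ltin; rewrite /P (bigD1 (Ordinal ltin))//= addrCA ltrDl.
  by rewrite ltr_pwDl// sumr_ge0.
have P0 : 0 < P by rewrite /P ltr_pwDl// sumr_ge0.
have e'0 : 0 < e / (2 * pi * P) by rewrite divr_gt0 // mulr_gt0.
have [t tP] := cP n (fun i => b i / (2 * pi) / (D%:~R * ratr (q i))) _ e'0.
exists (2 * pi * D%:~R * t%:R) => i ltin; have [l lP] := tP i ltin.
have [p qE] := pP i ltin; exists (p * l).
have pE : p%:~R = D%:~R * ratr (q i) :> R.
  rewrite qE fmorph_div /= !ratr_int mulrCA mulfV ?mulr1// intr_eq0//.
have p0 : (p%:~R : R) != 0.
  by rewrite pE mulf_neq0 ?intr_eq0// fmorph_eq0 q0.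
rewrite -pE in lP; have -> : c i * ratr (q i) * (2 * pi * D%:~R * t%:R) - b i -
    2 * pi * (p * l)%:~R =
  2 * pi * p%:~R * (t%:R * c i - b i / (2 * pi) / p%:~R - l%:~R).
  have -> : c i * ratr (q i) * (2 * pi * D%:~R * t%:R) =
     c i * (D%:~R * ratr (q i)) * (2 * pi * t%:R) by ring.
  rewrite -pE intrM; move: (2 * pi) pi2 => tau tau0; field.
  by rewrite p0 gt_eqF.
rewrite normrM (normrM (2 * pi)) (gtr0_norm pi2).
have pP' : 0 <= 2 * pi * `|p%:~R : R| by rewrite mulr_ge0// ltW.
apply: le_lt_trans (ler_wpM2l pP' (ltW lP)) _.
have -> : 2 * pi * `|p%:~R : R| * (e / (2 * pi * P)) = e * (`|p%:~R : R| / P).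
  move: (2 * pi) pi2 => tau tau0; field.
  by rewrite !gt_eqF.
by rewrite gtr_pMr// ltr_pdivrMr// mul1r pE Pi.
Qed.

End cantor.

(** * Cyclic chains in subgroups of the rationals *)

Definition cyclic_subgroup (G : zmodClosed rat) :=
  exists2 g : rat, g \in G & forall x, x \in G -> exists n : int, x = g *~ n.

(** A subgroup of the rationals is the increasing union of the cyclic groups
    generated by g 0, g 1, ...; the indices a of each in the next are those of
    the solenoid attached to the subgroup. A cyclic subgroup gets the constant
    chain, all of whose indices are 1. *)
Definition generator_chain (G : zmodClosed rat) (g : nat -> rat) (a : nat -> nat) :=
  [/\ forall k, g k \in G /\ g k != 0,
      forall k, g k = g k.+1 *+ a k.+1,
      forall y, y \in G -> exists k, exists n : int, y = g k *~ n &
      (cyclic_subgroup G /\ forall k, a k = 1%N) \/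
      (~ cyclic_subgroup G /\ solenoid_index a)].

(** Finitely generated subgroups of the rationals are cyclic, by Bezout over a
    common denominator; the sign of the generator is chosen to make the
    multiplicity of x a natural number. *)
Lemma rat_common_generator (G : zmodClosed rat) (x y : rat) :
  x \in G -> y \in G -> x != 0 ->
  exists2 h : rat, h \in G & exists (m : nat) (n : int), x = h *+ m /\ y = h *~ n.
Proof.
move=> xG yG x0.
pose p := numq x * denq y; pose q := numq y * denq x; pose D := denq x * denq y.
have D0 : D%:~R != 0 :> rat by rewrite intr_eq0 mulf_neq0 ?denq_neq0.
have dx0 : (denq x)%:~R != 0 :> rat by rewrite intr_eq0 denq_neq0.
have dy0 : (denq y)%:~R != 0 :> rat by rewrite intr_eq0 denq_neq0.
have xE : x = p%:~R / D%:~R.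
  by rewrite -{1}[x]divq_num_den /p /D !intrM; field; rewrite dx0 dy0.
have yE : y = q%:~R / D%:~R.
  by rewrite -{1}[y]divq_num_den /q /D !intrM; field; rewrite dx0 dy0.
clearbody p q D.
have [u [v uv]] := Bezoutz p q.
have [m pm] := dvdzP (dvdz_gcdl p q); have [n qn] := dvdzP (dvdz_gcdr p q).
pose h := (gcdz p q)%:~R / D%:~R : rat.
have hG : h \in G.
  have -> : h = x *~ u + y *~ v.
    by rewrite /h -uv intrD !intrM mulrDl -!mulrA -xE -yE !mulrzl.
  by rewrite rpredD // rpredMz.
have xh : x = h *~ m by rewrite xE {1}pm /h intrM -mulrA mulrzl.
have yh : y = h *~ n by rewrite yE {1}qn /h intrM -mulrA mulrzl.
case: m xh {pm} => m xh; first by exists h => //; exists m, n.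
exists (- h); first by rewrite rpredN.
exists m.+1, (- n); split; first by rewrite xh NegzE mulrNz mulNrn.
by rewrite mulrNz mulNrz opprK.
Qed.

(** Two successive enlargements of the group generated by h: the first absorbs
    y, the second absorbs an element z outside of the group so obtained, which
    makes the index greater than 1. *)
Lemma noncyclic_step (G : zmodClosed rat) (h y : rat) :
  ~ cyclic_subgroup G -> h \in G -> h != 0 -> y \in G ->
  exists h' : rat, exists b : nat,
    [/\ h' \in G, h' != 0, h = h' *+ b, (1 < b)%N & exists n : int, y = h' *~ n].
Proof.
move=> ncG hG h0 yG.
have [h1 h1G [m1 [n1 [hh1 yh1]]]] := rat_common_generator hG yG h0.
have h10 : h1 != 0 by apply: contra_neq h0; rewrite hh1 => ->; rewrite mul0rn.
have [z zG zh1] : exists2 z, z \in G & forall n : int, z != h1 *~ n.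
  apply: contrapT => nz; apply: ncG; exists h1 => // x xG.
  apply: contrapT => nx; apply: nz; exists x => // n.
  by apply/eqP => xn; apply: nx; exists n.
have [h2 h2G [m2 [n2 [hh2 zh2]]]] := rat_common_generator h1G zG h10.
have m20 : m2 != 0%N by apply: contra_neq h10; rewrite hh2 => ->.
have m10 : m1 != 0%N by apply: contra_neq h0; rewrite hh1 => ->.
have m21 : m2 != 1%N.
  by apply: contraNneq (zh1 n2) => m21; rewrite zh2 hh2 m21.
exists h2, (m2 * m1)%N; split => //.
- by apply: contra_neq h10; rewrite hh2 => ->; rewrite mul0rn.
- by rewrite hh1 hh2 mulrnA.
- by nia.
- by exists (m2%:Z * n1); rewrite yh1 hh2 mulrzA.
Qed.

(** Enumerate the subgroup and absorb its k-th element at step k, so that the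
    union is everything; the strictness of each step makes all the indices at
    least 2. *)
Lemma generator_chain_exists (G : zmodClosed rat) (x : rat) : x \in G -> x != 0 ->
  exists (g : nat -> rat) (a : nat -> nat), generator_chain G g a.
Proof.
move=> xG x0; have [cG|ncG] := pselect (cyclic_subgroup G).
  have [g gG gP] := cG; exists (fun=> g), (fun=> 1%N); split=> //.
  - move=> _; split=> //; apply: contra_neq x0 => g0.
    by have [n ->] := gP x xG; rewrite g0 mul0rz.
  - by move=> y /gP[n ->]; exists 0%N, n.
  - by left.
pose y k : rat := if unpickle k is Some z then (if z \in G then z else 0) else 0.
have yG k : y k \in G.
  by rewrite /y; case: unpickle => [z|]; [case: ifP|]; rewrite ?rpred0.
pose T := {h : rat | h \in G & h != 0}.
have step (kh : nat * T) : {h'b : T * nat | [/\ sval kh.2 = sval h'b.1 *+ h'b.2,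
    (1 < h'b.2)%N & exists n : int, y kh.1 = sval h'b.1 *~ n]}.
  case: kh => k [h hG h0] /=; apply: cid.
  have [h' [b [h'G h'0 hE b1 yE]]] := noncyclic_step ncG hG h0 (yG k).
  by exists (exist2 _ _ h' h'G h'0, b).
pose gt := fix gt k : T := if k is k'.+1 then (sval (step (k', gt k'))).1 else
  exist2 _ _ x xG x0.
pose a k := if k is k'.+1 then (sval (step (k', gt k'))).2 else 1%N.
exists (fun k => sval (gt k)), a; split.
- by move=> k; split; case: (gt k).
- by move=> k /=; case: (step (k, gt k)) => [[h b] []].
- move=> z zG; exists (pickle z).+1 => /=.
  case: (step _) => [[h b] [_ _ [n]]] /=; rewrite /y pickleK zG => ->.
  by exists n.
- right; split=> //; split=> // -[//|k] _ /=.
  by case: (step _) => [[h b] []].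
Qed.

Lemma rat_commensurable (y z : rat) : z != 0 ->
  exists p : int, exists2 q : int, q != 0 & y *~ q = z *~ p.
Proof.
move=> z0; exists (numq y * denq z), (numq z * denq y).
  by rewrite mulf_neq0 ?numq_eq0 ?denq_neq0.
have dy0 : (denq y)%:~R != 0 :> rat by rewrite intr_eq0 denq_neq0.
have dz0 : (denq z)%:~R != 0 :> rat by rewrite intr_eq0 denq_neq0.
rewrite -mulrzr -[RHS]mulrzr.
move: (numq y) (denq y) (numq z) (denq z) (divq_num_den y) (divq_num_den z) dy0 dz0.
move=> a b c d <- <- b0 d0; rewrite (intrM _ c) (intrM _ a).
by field; rewrite b0 d0.
Qed.

(** Two rationals always satisfy a nontrivial integral relation, so a free basis
    has at most one element. *)
Lemma free_abelian_cyclic (A : set rat) : (exists2 x, A x & x != 0) ->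
  free_abelian A ->
  exists2 g, A g & forall x, A x -> exists n : int, x = g *~ n.
Proof.
move=> [x Ax x0] [J [f [fD [fA finj fsurj]]]].
have fin0 : fin_supp_int (0 : J -> int).
  split=> //; apply: (sub_finite_set _ (finite_set0 J)) => j /=.
  by [].
have f0 : f 0 = 0 by apply: (addrI (f 0)); rewrite -fD // !addr0.
pose e (j : J) (n : int) : J -> int := fun j' => if `[< j' = j >] then n else 0.
have eS j n : fin_supp_int (e j n).
  split=> //; apply: (sub_finite_set (B := [set j])) => //.
  by move=> j' /=; rewrite /e; case: asboolP.
have e0 j : e j 0 = 0 by apply/funext => j'; rewrite /e; case: asboolP.
have eD j n m : e j (n + m) = e j n + e j m.
  by apply/funext => j'; rewrite /GRing.add /= /e; case: asboolP.
have fe j n : f (e j n) = f (e j 1) *~ n.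
  have fen (k : nat) : f (e j k) = f (e j 1) *+ k.
    elim: k => [|k IHk]; first by rewrite e0 f0 mulr0n.
    by rewrite -addn1 PoszD eD fD // IHk mulrnDr.
  case: n => n; first exact: fen.
  apply: (addrI (f (e j n.+1))); rewrite -fD // -eD fen NegzE mulrNz !subrr.
  by rewrite e0 f0.
have eN0 j n : n != 0 -> f (e j n) != 0.
  move=> n0; apply/eqP; rewrite -f0 => /finj; rewrite !inE.
  move=> /(_ (eS _ _) fin0) /(congr1 (@^~ j)).
  by rewrite /e asboolT // => n0'; rewrite n0' eqxx in n0.
have Jsub (j j' : J) : j = j'.
  apply: contrapT => jj'.
  have z0 := eN0 j' 1 isT.
  have [p [q q0 yz]] := rat_commensurable (f (e j 1)) z0.
  have := congr1 (@^~ j) (finj (e j q) (e j' p) (mem_set (eS _ _))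
    (mem_set (eS _ _)) (etrans (fe _ _) (etrans yz (esym (fe _ _))))).
  rewrite /e asboolT // asboolF // => q0'; by rewrite q0' eqxx in q0.
have [s sS sx] := fsurj x Ax.
have [j sj] : exists j, s j != 0.
  apply: contrapT => nj; move: x0; rewrite -sx -f0; apply/negP; rewrite negbK.
  apply/eqP; congr f; apply/funext => j; apply: contrapT => sj; apply: nj.
  by exists j; apply/eqP.
exists (f (e j 1)); first by apply: fA; exact: eS.
move=> y /fsurj[u uS <-]; exists (u j); rewrite -fe; congr f.
by apply/funext => j'; rewrite /e asboolT // (Jsub j' j).
Qed.

Lemma cyclic_free_abelian (V : zmodType) (A : set V) (g : V) :
  (forall n : int, A (g *~ n)) -> (forall n : int, g *~ n = 0 -> n = 0) ->
  (forall x, A x -> exists n : int, x = g *~ n) -> free_abelian A.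
Proof.
move=> An g_inj gA; exists unit, (fun x => g *~ x tt); split.
  by move=> x y _ _; rewrite -mulrzDr.
split.
- by move=> x _; exact: An.
- move=> x y _ _ /eqP; rewrite -subr_eq0 -mulrzBr => /eqP/g_inj/eqP.
  by rewrite subr_eq0 => /eqP xy; apply/funext => -[].
- move=> y /gA[n ->]; exists (fun=> n) => //; split.
Qed.

Lemma free_abelianP (G : zmodClosed rat) (x : rat) : x \in G -> x != 0 ->
  free_abelian [set` G] <-> cyclic_subgroup G.
Proof.
move=> xG x0; split=> [|[g gG gP]].
  by apply: free_abelian_cyclic; exists x.
have g0 : g != 0.
  by apply: contra_neq x0 => g0; have [n ->] := gP x xG; rewrite g0 mul0rz.
apply: (@cyclic_free_abelian _ _ g) => //=.
  by move=> n; rewrite rpredMz.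
by move=> n /eqP; rewrite mulrz_eq0 (negbTE g0) orbF => /eqP.
Qed.

(** * Weighted sums over direct sums of groups *)

Lemma groups_isomorphic_of_inverse (U V : zmodType) (A : set U) (B : set V)
    (f : V -> U) :
  (forall x y, B x -> B y -> B (x + y)) ->
  (forall x y, B x -> B y -> f (x + y) = f x + f y) ->
  set_bij B A f -> groups_isomorphic A B.
Proof.
move=> BD fD [fA finj fsurj].
pose g u := xget 0 [set v | B v /\ f v = u].
have gP u : A u -> B (g u) /\ f (g u) = u.
  move=> /fsurj[v Bv fv].
  by have := @xgetPex _ 0 [set v | B v /\ f v = u]; apply; exists v.
have inj v w : B v -> B w -> f v = f w -> v = w.
  by move=> Bv Bw; apply: finj; rewrite inE.
have AD x y : A x -> A y -> A (x + y).
  by move=> /fsurj[v Bv <-] /fsurj[w Bw <-]; rewrite -fD //; apply: fA; exact: BD.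
exists g; split.
  move=> x y Ax Ay; have [Bx fx] := gP _ Ax; have [By fy] := gP _ Ay.
  have [Bxy fxy] := gP _ (AD _ _ Ax Ay).
  by apply: inj => //; [exact: BD|rewrite fD // fxy fx fy].
split.
- by move=> u /gP[].
- move=> u u'; rewrite !inE => /gP[_ gu] /gP[_ gu'] gg.
  by rewrite -gu -gu' gg.
- move=> v Bv; exists (f v); first exact: fA.
  by have [Bg fg] := gP _ (fA _ Bv); apply: inj.
Qed.

Section direct_sum.
Variables (J : choiceType) (V : zmodType) (B : J -> set V).
Hypothesis B0 : forall j, B j 0.
Hypothesis BD : forall j x y, B j x -> B j y -> B j (x + y).

Definition single (j : J) (v : V) : J -> V := fun j' => if j' == j then v else 0.

Lemma direct_sum0 : direct_sum B 0.
Proof.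
split=> //; apply: (sub_finite_set _ (finite_set0 J)) => j /=.
by move/eqP.
Qed.

Lemma direct_sumD x y : direct_sum B x -> direct_sum B y -> direct_sum B (x + y).
Proof.
move=> [fx Bx] [fy By]; split=> [|j]; last exact: BD.
have fxy : finite_set ([set j | x j != 0] `|` [set j | y j != 0]).
  by rewrite finite_setU.
apply: sub_finite_set fxy => j /=; rewrite /GRing.add /=.
have [->|] := eqVneq (x j) 0; last by left.
by rewrite add0r; right.
Qed.

Lemma direct_sum_single j v : B j v -> direct_sum B (single j v).
Proof.
move=> Bv; split=> [|j']; last first.
  by rewrite /single; case: eqP => // ->.
apply: (sub_finite_set _ (finite_set1 j)) => j' /=.
by rewrite /single; have [|_] := eqVneq j' j; rewrite ?eqxx.
Qed.

Variables (R : zmodType) (w : J -> V -> R).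
Hypothesis w0 : forall j, w j 0 = 0.
Hypothesis wD : forall j x y, w j (x + y) = w j x + w j y.

(** The linear combination with weights w j; both the frequency module and its
    description as a direct sum are images of direct sums under such maps. *)
Definition wsum (x : J -> V) : R := \sum_(j \in [set: J]) w j (x j).

Lemma wsum_fset x (A : {fset J}) :
  (forall j, x j != 0 -> j \in A) -> wsum x = \sum_(j <- A) w j (x j).
Proof.
move=> xA; apply: fsbigTE => j /negP jA.
by have [->|/xA//] := eqVneq (x j) 0.
Qed.

Lemma direct_sum_supp x : direct_sum B x ->
  exists A : {fset J}, forall j, x j != 0 = (j \in A).
Proof.
move=> [fx _]; exists (fset_set [set j | x j != 0]) => j.
by rewrite in_fset_set // mem_setE.
Qed.

Lemma wsumD x y : direct_sum B x -> direct_sum B y ->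
  wsum (x + y) = wsum x + wsum y.
Proof.
move=> /direct_sum_supp[A xA] /direct_sum_supp[A' yA'].
rewrite !(@wsum_fset _ (A `|` A')%fset).
- by rewrite -big_split; apply: eq_bigr => j _; exact: wD.
- by move=> j; rewrite yA' in_fsetU => ->; rewrite orbT.
- by move=> j; rewrite xA in_fsetU => ->.
- move=> j; rewrite in_fsetU -xA -yA' /GRing.add /=.
  by have [->|//] := eqVneq (x j) 0; rewrite add0r.
Qed.

Lemma wsum0 : wsum 0 = 0.
Proof. by rewrite (@wsum_fset _ fset0) ?big_seq_fset0 // => j /eqP. Qed.

Lemma wsum_single j v : wsum (single j v) = w j v.
Proof.
rewrite (@wsum_fset _ [fset j]%fset) ?big_seq_fset1 /single ?eqxx //.
by move=> j'; rewrite in_fset1; have [|_] := eqVneq j' j; rewrite ?eqxx.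
Qed.

Lemma wsum_in (H : set R) : H 0 -> (forall a b, H a -> H b -> H (a + b)) ->
  (forall j v, B j v -> H (w j v)) -> wsum @` direct_sum B `<=` H.
Proof.
move=> H0 HD Hw _ [x xB <-]; have [A xA] := direct_sum_supp xB.
rewrite (@wsum_fset _ A); last by move=> j; rewrite xA.
by elim/big_ind: _ => // j _; apply: Hw; case: xB.
Qed.

Lemma image_wsum0 : (wsum @` direct_sum B) 0.
Proof. by exists 0; [exact: direct_sum0|exact: wsum0]. Qed.

Lemma image_wsumD a b : (wsum @` direct_sum B) a -> (wsum @` direct_sum B) b ->
  (wsum @` direct_sum B) (a + b).
Proof.
move=> [x Bx <-] [y By <-]; exists (x + y); first exact: direct_sumD.
exact: wsumD.
Qed.

Lemma image_wsum_single j v : B j v -> (wsum @` direct_sum B) (w j v).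
Proof.
by move=> Bv; exists (single j v); [exact: direct_sum_single|exact: wsum_single].
Qed.

End direct_sum.

(** Each image is the additive monoid generated by the values at the elements
    with a single nonzero coordinate, so comparing those values is enough: no
    double sum over pairs of indices has to be rearranged. *)
Lemma image_wsum_eq (R : zmodType) (J K : choiceType) (V W : zmodType)
   (B : J -> set V) (C : K -> set W) (w : J -> V -> R) (u : K -> W -> R) :
  (forall j, B j 0) -> (forall j x y, B j x -> B j y -> B j (x + y)) ->
  (forall k, C k 0) -> (forall k x y, C k x -> C k y -> C k (x + y)) ->
  (forall j, w j 0 = 0) -> (forall j x y, w j (x + y) = w j x + w j y) ->
  (forall k, u k 0 = 0) -> (forall k x y, u k (x + y) = u k x + u k y) ->
  (forall j x, B j x -> (wsum u @` direct_sum C) (w j x)) ->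
  (forall k y, C k y -> (wsum w @` direct_sum B) (u k y)) ->
  wsum w @` direct_sum B = wsum u @` direct_sum C.
Proof.
move=> B0 BD C0 CD w0 wD u0 uD wu uw; apply/seteqP; split; apply: wsum_in => //.
- exact: image_wsum0.
- exact: image_wsumD.
- exact: image_wsum0.
- exact: image_wsumD.
Qed.

(** * Rational independence *)

(** A relation between the c_i with a nonzero coefficient z_{i0} would keep the
    sum of the coordinates c_i z_i t equal to 0 at all times t, whereas density
    brings the coordinate i0 close to pi and the other ones close to 0
    modulo 2 pi. *)
Lemma dense_independent (R : realType) (c : nat -> R) (s : seq nat)
    (z : nat -> rat) : dense_frequencies c -> uniq s ->
  \sum_(i <- s) c i * ratr (z i) = 0 -> forall i, i \in s -> z i = 0.
Proof.
move=> dense_c us sz i0 si0; apply: contrapT => /eqP zi0.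
(* The value 1 replaces the vanishing coefficients, because the factors in
   the density property have to be nonzero. *)
pose q i := if z i == 0 then 1 else z i.
pose b i : R := if i == i0 then pi else 0.
pose n := (\max_(i <- s) i).+1.
have sn i : i \in s -> (i < n)%N by move=> si; rewrite ltnS leq_bigmax_seq.
(* With this tolerance the errors of all the coordinates add up to less than pi. *)
have e0 : 0 < pi / (size s).+1%:R :> R by rewrite divr_gt0 // pi_gt0.
have q0 i : (i < n)%N -> q i != 0 by rewrite /q; case: (eqVneq (z i) 0).
have [t tP] := @dense_c _ _ b _ e0 q0; set e := pi / _ in e0 tP.
have bound : exists L : int,
    `|\sum_(i <- s) (c i * ratr (z i) * t - b i) - 2 * pi * L%:~R| <= e *+ size s.
  have : {subset s <= s} by [].
  elim: {1 3 4}s => [_|j r IHr rs].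
    by exists 0; rewrite big_nil mulr0 subr0 normr0.
  have [|L LP] := IHr; first by move=> i ir; apply: rs; rewrite inE ir orbT.
  have /sn jn : j \in s by apply: rs; rewrite inE eqxx.
  have [l lP] := tP j jn.
  have [zj|zj] := eqVneq (z j) 0.
    exists L; rewrite big_cons zj rmorph0 mulr0 mul0r /b.
    case: eqP => [ji|_]; first by rewrite -ji zj eqxx in zi0.
    by rewrite subrr add0r /= (mulrS e); apply: le_trans LP _; rewrite lerDr ltW.
  exists (l + L); rewrite big_cons intrD mulrDr /= (mulrS e).
  rewrite {1}/q (negbTE zj) in lP.
  rewrite opprD addrACA; apply: le_trans (ler_normD _ _) _.
  by rewrite lerD // ltW.
have [L] := bound.
have -> : \sum_(i <- s) (c i * ratr (z i) * t - b i) = - pi.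
  rewrite big_split /= -mulr_suml sz mul0r add0r sumrN; congr (- _).
  rewrite (bigD1_seq i0) //= /b eqxx big1 ?addr0 // => i /negbTE ->.
  by [].
have se : e *+ size s < pi.
  rewrite -mulr_natr /e mulrAC ltr_pdivrMr // ltr_pM2l ?pi_gt0 //.
  by rewrite ltr_nat.
have -> : - pi - 2 * pi * L%:~R = - (pi * (1 + 2 * L)%:~R) :> R.
  by rewrite intrD intrM; ring.
rewrite normrN normrM (gtr0_norm (pi_gt0 R)) => /le_lt_trans /(_ se).
rewrite gtr_pMr ?pi_gt0 // -intr_norm -[1]/(1%:~R) ltr_int; lia.
Qed.

(** * Closures of orbits *)

Lemma chain_prod (V : nmodType) (x : nat -> V) (a : nat -> nat) :
  (forall k, x k = x k.+1 *+ a k.+1) ->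
  forall k K, (k <= K)%N -> x k = x K *+ \prod_(k <= l < K) a l.+1.
Proof.
move=> xa k K kK; rewrite -(subnKC kK); elim: (K - k)%N => [|d IHd].
  by rewrite addn0 big_geq.
rewrite {1}IHd addnS big_nat_recr ?leq_addr //= xa mulnC mulrnA.
by [].
Qed.

Section orbit_closure.
Variables (R : realType) (I : countType) (g : I -> nat -> rat).
Variables (a : I -> nat -> nat) (c : nat -> R).
Hypothesis g0 : forall i k, g i k != 0.
Hypothesis ga : forall i k, g i k = g i k.+1 *+ a i k.+1.
Hypothesis dense_c : dense_frequencies c.

(** The velocities c_i g_{i,k}, with the pairs (i, k) coded by natural numbers;
    a coordinate of the torus that codes no pair stands still. *)
Definition chain_frequency (j : nat) : R :=
  if pickle_inv j is Some (i, k) then c (pickle (i : I)) * ratr (g i k) else 0.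

(** The closure of the orbit of 0, and a copy of the product of the solenoids of
    the sequences a i. *)
Definition chain_group (psi : nat -> circle R) : Prop :=
  (forall i k, psi (pickle (i : I, k)) = psi (pickle (i, k.+1)) *+ a i k.+1) /\
  (forall j, @pickle_inv (I * nat)%type j = None -> psi j = 0).

Lemma chain_frequencyE i k :
  chain_frequency (pickle (i, k)) = c (pickle i) * ratr (g i k).
Proof. by rewrite /chain_frequency pickleK_inv. Qed.

Lemma closed_chain_group (theta : torus R) :
  closed [set eta : torus R | chain_group (fun j => eta j - theta j)].
Proof.
have cj j : continuous (fun eta : torus R => eta j - theta j).
  apply: circleD_continuous; first exact: continuous_eval.
  exact: (@cst_continuous (torus R) (circle R)).
rewrite (_ : mkset _ =
  \bigcap_(ik : I * nat) ((fun eta : torus R =>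
     (eta (pickle ik) - theta (pickle ik))
     - (eta (pickle (ik.1, ik.2.+1)) - theta (pickle (ik.1, ik.2.+1)))
       *+ a ik.1 ik.2.+1) @^-1` [set 0]) `&`
  \bigcap_(j in [set j | @pickle_inv (I * nat)%type j = None])
     ((fun eta : torus R => eta j - theta j) @^-1` [set 0])).
  have cl0 (f : torus R -> circle R) : continuous f -> closed (f @^-1` [set 0]).
    move=> cf; apply: preimage_closed; last exact: circle_closed0.
    by move=> eta _; exact: cf.
  apply: closedI; apply: closed_bigI => j _; apply: cl0; last exact: cj.
  apply: circleD_continuous; first exact: cj.
  by apply: circleN_continuous; apply: circleMn_continuous; exact: cj.
apply/seteqP; split=> eta /= [h1 h2]; split=> //.
- by move=> [i k] _ /=; rewrite h1 subrr.
- by move=> i k; apply/eqP; rewrite -subr_eq0; apply/eqP; exact: (h1 (i, k)).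
Qed.

Lemma flow_orbit_chain_group (theta : torus R) (t : R) :
  chain_group (fun j => kronecker_flow chain_frequency t theta j - theta j).
Proof.
rewrite /kronecker_flow; split=> [i k|j jN]; rewrite addrAC subrr add0r.
  rewrite [_ (pickle (i, k.+1)) + _]addrC addrK.
  by rewrite !chain_frequencyE -to_circleMn ga raddfMn /= mulrnAr mulrnAl.
by rewrite /chain_frequency jN mul0r to_circle0.
Qed.

(** Only the coordinates (i, K) with K large have to be approximated: the
    coordinates (i, k) with k <= K are multiples of them by a fixed integer p,
    both along the flow and in the group, so that the tolerance is divided
    beforehand by a bound for these integers. *)
Lemma chain_group_approx (psi : nat -> circle R) n : chain_group psi ->
  exists t : R, forall j, (j < n)%N -> exists2 d : R, `|d| < n.+1%:R^-1 &
    to_circle (chain_frequency j * t) = psi j + to_circle d.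
Proof.
move=> [psia psi0].
pose K := (\max_(j < n)
  if @pickle_inv (I * nat)%type j is Some (i, k) then maxn (pickle i) k else 0%N).+1.
pose P j := if @pickle_inv (I * nat)%type j is Some (i, k)
  then \prod_(k <= l < K) a i l.+1 else 0%N.
pose B := (\max_(j < n) P j).+1.
pose q m := if @pickle_inv I m is Some i then g i K else 1.
have [b bP] : {b : nat -> R & forall m, if @pickle_inv I m is Some i then
    psi (pickle (i, K)) = to_circle (b m) else True}.
  apply: (@choice _ _ (fun m b => if @pickle_inv I m is Some i then
    psi (pickle (i, K)) = to_circle b else True)) => m.
  by case: pickle_inv => [i|]; [exact: to_circle_surj|exists 0].
have e0 : 0 < (n.+1%:R * B%:R)^-1 :> R by rewrite invr_gt0 mulr_gt0 // ltr0n.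
have q0 m : (m < K)%N -> q m != 0 by rewrite /q; case: pickle_inv.
have [t tP] := @dense_c _ _ b _ e0 q0; exists t => j jn.
case E : (@pickle_inv (I * nat)%type j) => [[i k]|]; last first.
  exists 0; first by rewrite normr0 invr_gt0 ltr0n.
  by rewrite psi0 // /chain_frequency E mul0r to_circle0 addr0.
have jE : pickle (i, k) = j by have := @pickle_invK (I * nat)%type j; rewrite E.
have [iK kK] : (pickle i < K)%N /\ (k <= K)%N.
  have : (maxn (pickle i) k < K)%N.
    rewrite ltnS; apply: (leq_trans _ (leq_bigmax (Ordinal jn))).
    by rewrite /= E.
  by rewrite gtn_max => /andP[? /ltnW].
have PB : (\prod_(k <= l < K) a i l.+1 <= B)%N.
  apply: leqW; apply: (leq_trans _ (leq_bigmax (Ordinal jn))).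
  by rewrite /P /= E.
have [l] := tP _ iK; have := bP (pickle i); rewrite /q !pickleK_inv => psiK.
have psik := chain_prod (psia i) kK; have gk := chain_prod (ga i) kK.
move: psik gk PB; set p := (\prod_(_ <= _ < _) _)%N => psik gk pB.
set d := (X in `|X| < _) => dB.
exists (d *+ p).
  rewrite normrMn; apply: (@le_lt_trans _ _ (`|d| *+ B)); first by
    rewrite -[leLHS]mulr_natr -[leRHS]mulr_natr ler_wpM2l // ler_nat.
  rewrite -[ltLHS]mulr_natr -ltr_pdivlMr ?ltr0n // (lt_le_trans dB) //.
  by rewrite invfM.
have -> : psi j = psi (pickle (i, k)) by rewrite jE.
rewrite psik psiK -jE chain_frequencyE gk raddfMn /= mulrnAr mulrnAl.
rewrite !to_circleMn -mulrnDl; congr (_ *+ p); rewrite -to_circleD.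
by rewrite -[RHS](to_circle2pi _ l); congr to_circle; rewrite /d; ring.
Qed.

(** Translation by theta reduces to the orbit of 0. The group is closed and
    contains this orbit; conversely a sequence of approximations with tolerance
    1 / (n+1) on the first n coordinates converges in the product topology. *)
Lemma closure_flow_orbit (theta : torus R) :
  closure (flow_orbit chain_frequency theta) =
  [set eta : torus R | chain_group (fun j => eta j - theta j)].
Proof.
apply/seteqP; split=> [|eta etaS].
  rewrite ((closure_id _).1 (@closed_chain_group theta)).
  apply: closureS => _ [t _ <-]; exact: flow_orbit_chain_group.
have [t tP] : {t : nat -> R & forall n j, (j < n)%N ->
    exists2 d : R, `|d| < n.+1%:R^-1 &
    to_circle (chain_frequency j * t n) = (eta j - theta j) + to_circle d}.
  apply: (@choice _ _ (fun n t => forall j, (j < n)%N ->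
    exists2 d : R, `|d| < n.+1%:R^-1 &
    to_circle (chain_frequency j * t) = (eta j - theta j) + to_circle d)) => n.
  exact: (chain_group_approx n etaS).
pose u n := kronecker_flow chain_frequency (t n) theta : torus R.
have ucvg : u @ \oo --> eta.
  apply: cvg_prod_topology => j U.
  have [x xE] := to_circle_surj (eta j); rewrite xE nbhs_to_circle.
  move=> /nbhs_ballP[e /= e0 eU].
  suff : \forall n \near \oo, U (u n j) by [].
  near=> n; have [|d dn uE] := tP n j; first by near: n; exact: nbhs_infty_gt.
  rewrite /u /kronecker_flow /= uE addrA (addrC (theta j)) subrK xE -to_circleD.
  apply: eU; rewrite -ball_normE /= opprD addrA subrr add0r normrN.
  apply: lt_trans dn _; near: n; exact: near_infty_natSinv_lt (PosNum e0).
apply: (closed_cvg _ (@closed_closure _ _) _ _ ucvg).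
by apply: nearW => n; apply: subset_closure; exists (t n).
Unshelve. all: by end_near. Qed.

End orbit_closure.

(** * Orbit closures as products of solenoids *)

(** A point of the coset is determined by its coordinates that code pairs, and
    these are grouped according to i. *)
Lemma chain_group_homeomorphic (R : realType) (I : countType)
    (a : I -> nat -> nat) (theta : torus R) :
  homeomorphic
    (set_type [set eta : torus R | chain_group a (fun j => eta j - theta j)])
    (prod_topology (fun i => set_type (@solenoid R (a i)))).
Proof.
set A := mkset _.
have fS (x : set_type A) i : solenoid (a i)
    (fun k => set_val x (pickle (i, k)) - theta (pickle (i, k))).
  by move=> k; have /set_mem[xS _] := valP x; exact: xS.
pose f (x : set_type A) : prod_topology (fun i => set_type (@solenoid R (a i))) :=
  fun i => SigSub (mem_set (fS x i)).
pose glue (y : prod_topology (fun i => set_type (@solenoid R (a i)))) : torus R :=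
  fun j => theta j +
    (if @pickle_inv (I * nat)%type j is Some ik then set_val (y ik.1) ik.2 else 0).
have glueA y : A (glue y).
  split=> [i k|j jN]; rewrite /glue addrAC subrr add0r; last by rewrite jN.
  rewrite [_ (pickle (i, k.+1)) + _]addrC addrK !pickleK_inv.
  by have /set_mem := valP (y i); apply.
exists f, (fun y => SigSub (mem_set (glueA y))); split.
- move=> x; apply: val_inj; apply/funext => j; rewrite /= /glue /=.
  have /set_mem[_ x0] := valP x.
  case E : pickle_inv => [[i k]|]; last by rewrite -(x0 _ E) addrC subrK.
  have <- : pickle (i, k) = j by have := @pickle_invK (I * nat)%type j; rewrite E.
  by rewrite addrC subrK.
- move=> y; apply: functional_extensionality_dep => i; apply: val_inj.
  apply/funext => k.
  change (glue y (pickle (i, k)) - theta (pickle (i, k)) = set_val (y i) k).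
  by rewrite /glue pickleK_inv addrAC subrr add0r.
- apply: continuous_prod_topology => i; apply: continuous_set_type.
  apply: continuous_prod_topology => k.
  apply: circleD_continuous; last exact: cst_continuous.
  exact: (@continuous_eval_set_val _ (fun=> circle R)).
- apply: continuous_set_type; apply: continuous_prod_topology => j.
  apply: circleD_continuous; first exact: cst_continuous.
  case: pickle_inv => [[i k]|]; last exact: cst_continuous.
  move=> y /=; apply: (@continuous_comp _ _ _
    (fun y : prod_topology (fun i => set_type (@solenoid R (a i))) => y i)
    (fun z : set_type (@solenoid R (a i)) => set_val z k)).
    exact: continuous_eval.
  exact: (@continuous_eval_set_val _ (fun=> circle R)).
Qed.

(** With all indices equal to 1, the coordinates of a point of the solenoid are
    all equal. *)
Lemma diagonal_homeomorphic (R : realType) (a : nat -> nat) :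
  (forall k, a k = 1%N) -> homeomorphic (set_type (@solenoid R a)) (circle R).
Proof.
move=> a1.
have dS (p : circle R) : solenoid a (fun=> p) by move=> k; rewrite a1.
exists (fun x => set_val x 0%N), (fun p => SigSub (mem_set (dS p))); split=> //.
- move=> x; apply: val_inj; apply/funext => k /=.
  have /set_mem xS := valP x; elim: k => // k ->.
  by rewrite [LHS]xS a1.
- exact: (@continuous_eval_set_val _ (fun=> circle R)).
- apply: continuous_set_type; apply: continuous_prod_topology => k p.
  exact: cvg_id.
Qed.

(** * The frequency module *)

(** The isomorphism is the inverse of the map that sends (x_i) to the sum of the
    c_i x_i: it is injective since the c_i are rationally independent, and
    its image is the frequency module since g_{i,0}, g_{i,1}, ... generate G_i. *)
Lemma frequency_module_isomorphic (R : realType) (I : countType)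
   (G : I -> zmodClosed rat) (g : I -> nat -> rat) (c : nat -> R) :
   (forall i k, g i k \in G i) ->
   (forall i y, y \in G i -> exists k, exists n : int, y = g i k *~ n) ->
   dense_frequencies c ->
  groups_isomorphic (frequency_module (chain_frequency g c))
                    (direct_sum (fun i => [set` G i])).
Proof.
move=> gG gen dense_c.
pose w (i : I) (x : rat) : R := c (pickle i) * ratr x.
pose u (j : nat) (n : int) : R := chain_frequency g c j * n%:~R.
pose B := fun i => [set` G i].
have B0 i : B i 0 by rewrite /B /= rpred0.
have BD i x y : B i x -> B i y -> B i (x + y) by rewrite /B /=; exact: rpredD.
have w0 i : w i 0 = 0 by rewrite /w rmorph0 mulr0.
have wD i x y : w i (x + y) = w i x + w i y by rewrite /w rmorphD mulrDr.
have u0 j : u j 0 = 0 by rewrite /u mulr0.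
have uD j x y : u j (x + y) = u j x + u j y by rewrite /u intrD mulrDr.
have -> : frequency_module (chain_frequency g c) = wsum w @` direct_sum B.
  apply/esym; apply: (image_wsum_eq (u := u)) => //.
    move=> i x /gen[k [n ->]].
    have -> : w i (g i k *~ n) = u (pickle (i, k)) n.
      by rewrite /w /u chain_frequencyE raddfMz -mulrA mulrzr.
    exact: image_wsum_single.
  move=> j n _; rewrite /u /chain_frequency; case: pickle_inv => [[i k]|].
    have -> : c (pickle i) * ratr (g i k) * n%:~R = w i (g i k *~ n).
      by rewrite /w raddfMz -mulrA mulrzr.
    by apply: image_wsum_single => //; rewrite /B /= rpredMz.
  by rewrite mul0r; exact: image_wsum0.
apply: (@groups_isomorphic_of_inverse _ _ _ _ (wsum w)).
- exact: direct_sumD.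
- exact: wsumD.
split=> //.
move=> x y; rewrite !inE => Bx By xy.
have BN : direct_sum B (- y).
  case: By => fy By; split; last by move=> i; rewrite /B /= rpredN; exact: By.
  by apply: sub_finite_set fy => i /=; rewrite /GRing.opp /= oppr_eq0.
have Bxy := direct_sumD BD Bx BN; have [A xyA] := direct_sum_supp Bxy.
have : wsum w (x - y) = 0.
  rewrite (wsumD w0 wD Bx BN) xy -(wsumD w0 wD By BN) subrr.
  exact: wsum0.
rewrite (wsum_fset w0 (A := A)); last by move=> i; rewrite xyA.
pose z m := if @pickle_inv I m is Some i then (x - y) i else 0.
have -> : \sum_(i <- A) w i ((x - y) i) =
    \sum_(m <- map pickle A) c m * ratr (z m).
  by rewrite big_map; apply: eq_bigr => i _; rewrite /z pickleK_inv.
have uA : uniq (map (@pickle I) A).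
  by rewrite map_inj_uniq ?fset_uniq //; exact: pcan_inj pickleK.
move=> /(dense_independent dense_c uA) z0.
apply/funext => i; apply/eqP; rewrite -subr_eq0; apply/negPn; apply/negP.
move=> xyi; have iA : i \in A by rewrite -xyA.
have /eqP := z0 _ (map_f pickle iA); rewrite /z pickleK_inv.
by apply/negP.
Qed.

(** * Realization of direct sums of rational groups *)

Theorem theoremC (R : realType) (I : countType) (G : I -> zmodClosed rat)
    (G_nontrivial : forall i, exists2 x : rat, x \in G i & x != 0) :
  exists omega : nat -> R,
    groups_isomorphic (frequency_module omega)
                      (direct_sum (fun i => [set` G i])) /\
    forall theta : torus R,
      exists a : I -> nat -> nat,
        (forall i, solenoid_index (a i)) /\
        homeomorphic (set_type (closure (flow_orbit omega theta)))
          (prod_topology (fun i => orbit_factor R [set` G i] (a i))).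
Proof.
have [ga gaP] : {ga : I -> (nat -> rat) * (nat -> nat) &
    forall i, generator_chain (G i) (ga i).1 (ga i).2}.
  apply: (@choice _ _ (fun i ga => generator_chain (G i) ga.1 ga.2)) => i.
  have [x xG x0] := G_nontrivial i.
  have [g [a ga]] := generator_chain_exists xG x0.
  by exists (g, a).
pose g i := (ga i).1; pose a i := (ga i).2.
have [c dense_c] := @dense_frequencies_exist R.
exists (chain_frequency g c); split.
  apply: frequency_module_isomorphic => //.
    by move=> i k; have [gG _ _ _] := gaP i; case: (gG k).
  by move=> i; have [_ _ gen _] := gaP i.
move=> theta.
(* The factor of a free G_i is a circle, so that its sequence of indices is
   arbitrary. *)
exists (fun i => if `[< cyclic_subgroup (G i) >] then fun k => k.+1 else a i).
split.
  move=> i; have [_ _ _ aP] := gaP i; case: asboolP => [_|ncG].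
    by split=> // -[].
  by case: aP => -[].
rewrite (@closure_flow_orbit _ _ g a c) //; first last.
- by move=> i k; have [_ gk _ _] := gaP i; exact: gk.
- by move=> i k; have [gk _ _ _] := gaP i; case: (gk k).
apply: homeomorphic_trans (chain_group_homeomorphic a theta) _.
apply: homeomorphic_prod => i; have [x xG x0] := G_nontrivial i.
have [_ _ _ aP] := gaP i; rewrite /orbit_factor.
have free := free_abelianP xG x0.
case: aP => -[cG ai].
  by rewrite asboolT; [exact: diagonal_homeomorphic|exact/free].
rewrite asboolF; last by move/free.
by rewrite asboolF //; exact: homeomorphic_refl.
Qed.
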